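(* Let $q$ be a prime power, let $n\ge 1$ be an integer, let $a_2,\ldots,a_n$ be positive integers and let $d\geq 1$ be an integer. Then $$e_q(d;1,1,a_2,\ldots,a_n)=\min\{p_n,\; d\,q^{n-1}+p_{n-2}\}.$$
   Context: $\mathbb{F}_q$ is the finite field with $q$ elements and $\overline{\mathbb{F}}_q$ an algebraic closure. For integers $m\ge 0$, $p_m:=q^m+\cdots+q+1$, and $p_m:=0$ for $m<0$. For positive integers $a_0,\ldots,a_n$, the weighted projective space $\mathbb{P}(a_0,\ldots,a_n)$ over $\mathbb{F}_q$ is $\mathrm{Proj}\,S$, where $S=\mathbb{F}_q[X_0,\ldots,X_n]$ is graded by $\deg X_i=a_i$. Its geometric points are the classes $[x_0:\cdots:x_n]$ of $(x_0,\ldots,x_n)\in\overline{\mathbb{F}}_q^{\,n+1}\setminus\{0\}$ under the action $\lambda\cdot(x_0,\ldots,x_n)=(\lambda^{a_0}x_0,\ldots,\lambda^{a_n}x_n)$ of $\lambda\in\overline{\mathbb{F}}_q^{\ast}$. A point is $\mathbb{F}_q$-rational if $[x_0:\cdots:x_n]=[x_0^q:\cdots:x_n^q]$. $S_d$ is the space of weighted homogeneous polynomials of weighted degree $d$, i.e. of $F\in S$ with $F(\lambda^{a_0}X_0,\ldots,\lambda^{a_n}X_n)=\lambda^dF(X_0,\ldots,X_n)$ for all $\lambda\in\overline{\mathbb{F}}_q^{\ast}$. For $F\in S_d$, $V(F)$ is the hypersurface of zeros of $F$ in $\mathbb{P}(a_0,\ldots,a_n)$ and $V(F)(\mathbb{F}_q)$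 is its set of $\mathbb{F}_q$-rational points. Finally $$e_q(d;a_0,\ldots,a_n):=\max_{F\in S_d\setminus\{0\}}\sharp V(F)(\mathbb{F}_q).$$ In the claim the weights are $a_0=a_1=1$ and $a_2,\ldots,a_n$. *)

(* Defs.v *)
From HB Require Import structures.
From mathcomp Require Import all_boot all_order all_algebra all_field.
From mathcomp Require Import boolp classical_sets functions cardinality.
From mathcomp Require Import mpoly.

Set Implicit Arguments.
Unset Strict Implicit.
Unset Printing Implicit Defensive.

Import GRing.Theory.
Local Open Scope classical_set_scope.
Local Open Scope card_scope.
Local Open Scope ring_scope.

Definition pgeom (q : nat) (m : int) : nat :=
  if m is Posz k then (\sum_(i < k.+1) q ^ i)%N else 0%N.

Section WeightedProjectiveSpace.
Variables (F : finFieldType) (K : closedFieldType) (iota : {rmorphism F -> K}).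
Variables (n : nat) (a : 'I_n.+1 -> nat).

Notation coords := {ffun 'I_n.+1 -> K}.

Definition wact (l : K) (x : coords) : coords := [ffun i => l ^+ a i * x i].

Definition wclass (x : coords) : set coords :=
  [set wact l x | l in [set l : K | l != 0]].

Definition frob (x : coords) : coords := [ffun i => x i ^+ #|F|].

Definition whomog (d : nat) (f : {mpoly F[n.+1]}) : Prop :=
  forall l : K, l != 0 ->
    map_mpoly iota f \mPo [tuple l ^+ a i *: 'X_i | i < n.+1]
    = l ^+ d *: map_mpoly iota f.

(* The rational points of V(f). For weighted homogeneous f the vanishing of f
   does not depend on the representative x. *)
Definition rat_zeros (f : {mpoly F[n.+1]}) : set (set coords) :=
  [set wclass x | x in [set x : coords |
     [/\ x != 0, wclass x = wclass (frob x) & (map_mpoly iota f).@[x] = 0]]].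

(* N is the maximum, over nonzero f in S_d, of the number of rational points
   of V(f); finiteness of all these point sets is part of the assertion. *)
Definition is_e_q (d N : nat) : Prop :=
  (exists f, [/\ whomog d f, f != 0 & rat_zeros f #= `I_N]) /\
  (forall f, whomog d f -> f != 0 -> rat_zeros f #<= `I_N).

End WeightedProjectiveSpace.

(* Main.v *)
(* Let q = #|F|.  Every rational class has exactly q - 1 representatives over F,
   so a count of rational points is a count of nonzeros in F^(n+1), and the
   upper bound says that a weighted homogeneous f <> 0 of degree d has at least
   (q - 1) (q + 1 - d) q^(n-1) of them.

   If f involves only variables of weight >= 2, its ordinary degree is at most
   d - 1 and Schwartz-Zippel suffices.  Otherwise let X_i of weight 1 occur.  If
   all zeros have x_i = 0, counting the points with x_i <> 0 suffices.  If not,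
   a weighted shear X_j -> X_j + c_j X_i^(a_j) moves a zero to the i-th
   coordinate point, so X_i^d no longer occurs.  Let e < d be the degree in X_i.
   For e = 0 a variable has been eliminated.  For e >= 1, Schwartz-Zippel for the
   leading coefficient, of degree d - e >= 1, gives at least
   (q - e) (q - d + e) q^(n-1) nonzeros, which is enough since
   (e - 1) (d - e - 1) >= 0.

   The bound is attained by a product of linear forms in the two variables of
   weight 1. *)

Require Import Defs.
From HB Require Import structures.
From mathcomp Require Import all_boot all_order all_algebra all_field.
From mathcomp Require Import boolp classical_sets functions cardinality.
From mathcomp Require Import finmap mpoly.
From mathcomp Require Import zify.

Set Implicit Arguments.
Unset Strict Implicit.
Unset Printing Implicit Defensive.

Import GRing.Theory.
Local Open Scope ring_scope.

(** * Counting nonzeros of polynomials on affine space over a finite field *)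

Section AffineCount.
Variables (F : finFieldType) (n : nat).
Implicit Types (f : {mpoly F[n]}) (m : 'X_{1..n}) (x : {ffun 'I_n -> F}).

Definition nonzeros f := [set x : {ffun 'I_n -> F} | f.@[x] != 0].

Definition upd x (i : 'I_n) (t : F) : {ffun 'I_n -> F} :=
  [ffun j => if j == i then t else x j].

(** Both sides count pairs [(x, t)]: the involution exchanging [t] with [x i] turns a global count
    into counts along lines parallel to the [i]-th axis. *)
Lemma card_upd (i : 'I_n) (P : pred {ffun 'I_n -> F}) :
  (#|F| * #|[pred x | P x]| = \sum_x #|[pred t | P (upd x i t)]|)%N.
Proof.
pose h (u : {ffun 'I_n -> F} * F) := (upd u.1 i u.2, u.1 i).
have hK : involutive h.
  move=> [x t]; rewrite /h /=; congr pair; last by rewrite ffunE eqxx.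
  by apply/ffunP=> j; rewrite !ffunE; case: eqP => [->|].
transitivity (\sum_(u : {ffun 'I_n -> F} * F) P u.1)%N.
  rewrite -(pair_bigA _ (fun x (t : F) => P x : nat)) /=.
  under eq_bigr do rewrite sum_nat_const.
  rewrite -big_distrr /=; congr muln; rewrite -sum1_card big_mkcond /=.
  by apply: eq_bigr => x _; rewrite inE; case: (P x).
rewrite (reindex_inj (inv_inj hK)) /=.
rewrite -(pair_bigA _ (fun x (t : F) => P (upd x i t) : nat)) /=.
apply: eq_bigr => x _; rewrite -sum1_card [in RHS]big_mkcond.
by apply: eq_bigr => t _; rewrite inE; case: (P _).
Qed.

Definition mdrop (i : 'I_n) m : 'X_{1..n} :=
  [multinom if j == i then 0%N else m j | j < n].

(** The coefficient of ['X_i ^+ e] in [f], kept in the ring in all [n] variables so that its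
    nonzeros are still counted in F^n. *)
Definition lead_in (i : 'I_n) e f : {mpoly F[n]} :=
  \sum_(m <- msupp f | m i == e) f@_m *: 'X_[mdrop i m].

Lemma mdrop_inj (i : 'I_n) m1 m2 :
  m1 i = m2 i -> mdrop i m1 = mdrop i m2 -> m1 = m2.
Proof.
move=> e12 /mnmP d12; apply/mnmP=> j; have := d12 j; rewrite !mnmE.
by case: eqP => [->|].
Qed.

Lemma mcoeff_lead_in (i : 'I_n) e f m :
  m i = e -> (lead_in i e f)@_(mdrop i m) = f@_m.
Proof.
move=> me; rewrite /lead_in raddf_sum /= -big_filter.
have [mf|mf] := boolP (m \in msupp f); last first.
  rewrite big1_seq ?memN_msupp_eq0 // => m'; rewrite mem_filter => /andP[_].
  case/andP=> /eqP m'e m'f; rewrite mcoeffZ mcoeffX.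
  case: eqP => [E|]; last by rewrite mulr0.
  by move: mf; rewrite -(mdrop_inj _ E) ?m'f // me.
rewrite (bigD1_seq m) /= ?filter_uniq ?msupp_uniq ?mem_filter ?me ?eqxx //.
rewrite mcoeffZ mcoeffX eqxx mulr1 big1_seq ?addr0 // => m' /andP[m'm].
rewrite mem_filter => /andP[/eqP m'e _]; rewrite mcoeffZ mcoeffX.
case: eqP => [E|]; last by rewrite mulr0.
by move: m'm; rewrite (mdrop_inj _ E) ?eqxx // me.
Qed.

Lemma msupp_lead_in (i : 'I_n) e f m : m \in msupp (lead_in i e f) ->
  exists2 m', m' \in msupp f & m' i = e /\ m = mdrop i m'.
Proof.
move/msupp_sum_le => /flattenP[s /mapP[m']]; rewrite mem_filter.
case/andP=> /eqP m'e m'f -> /msuppZ_le; rewrite msuppX inE => /eqP ->.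
by exists m'.
Qed.

Lemma mdeg_mdrop (i : 'I_n) m : (mdeg (mdrop i m) + m i = mdeg m)%N.
Proof.
rewrite !mdegE (bigD1 i) //= [in RHS](bigD1 i) //= mnmE eqxx add0n addnC.
by congr (_ + _)%N; apply: eq_bigr => j /negPf ji; rewrite mnmE ji.
Qed.

(* On each line parallel to the [i]-th axis on which the leading coefficient
   does not vanish, [f] is a univariate polynomial of degree [e]. *)
Lemma nonzeros_lead_in (i : 'I_n) e f :
  (forall m, m \in msupp f -> (m i <= e)%N) ->
  ((#|F| - e) * #|nonzeros (lead_in i e f)| <= #|F| * #|nonzeros f|)%N.
Proof.
move=> le_e.
(* [p x] is the restriction of [f] to the line through [x] parallel to the [i]-th axis. *)
pose p x : {poly F} :=
  \sum_(m <- msupp f) (f@_m * \prod_j x j ^+ mdrop i m j) *: 'X^(m i).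
have pE x t : (p x).[t] = f.@[upd x i t].
  rewrite /p horner_sum mevalE; apply: eq_bigr => m _.
  rewrite hornerZ hornerXn -mulrA; congr (_ * _).
  rewrite [in RHS](bigD1 i) //= (bigD1 i) //= mnmE eqxx expr0 mul1r mulrC.
  rewrite ffunE eqxx; congr (_ * _).
  by apply: eq_bigr => j /negPf ji; rewrite mnmE ffunE ji.
have size_p x : (size (p x) <= e.+1)%N.
  rewrite /p; apply/leq_sizeP => k ek; rewrite coef_sum big1_seq // => m.
  case/andP=> _ mf; rewrite coefZ coefXn gtn_eqF ?mulr0 //.
  exact: leq_ltn_trans (le_e m mf) ek.
have coef_p x : (p x)`_e = (lead_in i e f).@[x].
  rewrite /p /lead_in coef_sum raddf_sum /= [in RHS]big_mkcond /=.
  apply: eq_bigr => m _; rewrite coefZ coefXn eq_sym.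
  by case: eqP => _; rewrite ?mulr0 // mulr1 mevalZ mevalX.
have -> : #|nonzeros f| = #|[pred x : {ffun _} | f.@[x] != 0]|.
  by rewrite cardsE.
rewrite (card_upd i) -[#|nonzeros _|]sum1_card big_distrr /= big_mkcond /=.
apply: leq_sum => x _; rewrite inE; case: ifPn => // nz; rewrite muln1.
(* Passing to the complement, it remains to bound by [e] the number of zeros on the line, which are
   roots of the nonzero [p x]. *)
rewrite leq_subLR -(cardC [pred t | f.@[upd x i t] != 0]) [leqLHS]addnC leq_add2r.
have p0 : p x != 0 by apply: contraNneq nz => p0; rewrite -coef_p p0 coef0.
rewrite -ltnS cardE; apply: leq_trans (size_p x); apply: max_poly_roots => //.
  apply/allP=> t; rewrite mem_enum !inE negbK => /eqP ft.
  by rewrite /root pE ft.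
exact: enum_uniq.
Qed.

Lemma lead_in_neq0 (i : 'I_n) f m :
  m \in msupp f -> lead_in i (m i) f != 0.
Proof.
rewrite mcoeff_msupp => mf; apply: contraNneq mf => l0.
by rewrite -(@mcoeff_lead_in i (m i)) // l0 mcoeff0.
Qed.

Lemma max_exponent (i : 'I_n) f : f != 0 ->
  exists2 m, m \in msupp f & forall m', m' \in msupp f -> (m' i <= m i)%N.
Proof.
rewrite -msupp_eq0; elim: (msupp f) => // m s IH _.
have [->|/IH[m1 m1s m1max]] := eqVneq s [::].
  by exists m; rewrite ?inE // => m'; rewrite inE => /eqP ->.
have [le|/ltnW le] := leqP (m i) (m1 i).
  by exists m1; rewrite ?inE ?m1s ?orbT // => m'; rewrite inE => /orP[/eqP->|/m1max].
exists m; rewrite ?inE ?eqxx // => m'; rewrite inE => /orP[/eqP->//|/m1max].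
by move/leq_trans; apply.
Qed.

Definition msupp_within (A : {set 'I_n}) f :=
  forall m, m \in msupp f -> forall j, j \notin A -> m j = 0%N.

(** Induction on the size of [A]: the leading coefficient in some ['X_i] has degree at most [s - e]
    and no longer involves ['X_i], while the ambient space stays F^n. Truncated subtraction makes
    the bound trivial for [s >= #|F|]. *)
Lemma schwartz_zippel (A : {set 'I_n}) s f : f != 0 -> msupp_within A f ->
  (forall m, m \in msupp f -> (mdeg m <= s)%N) ->
  ((#|F| - s) * #|F| ^ n <= #|F| * #|nonzeros f|)%N.
Proof.
have q0 : (0 < #|F|)%N by apply/card_gt0P; exists 0.
elim: {A}_.+1 {-2}A (ltnSn #|A|) s f => // k IH A; rewrite ltnS => kA s f f0 fA fs.
have [A0|[i iA]] := finset.set_0Vmem A.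
  have supp0 m : m \in msupp f -> m = 0%MM.
    by move=> mf; apply/mnmP=> j; rewrite mnm0E (fA m) // A0 inE.
  have fC : f = f@_0 *: 'X_[0].
    apply/mpolyP=> m; rewrite mcoeffZ mcoeffX; case: eqP => [<-|/eqP m0].
      by rewrite mulr1.
    rewrite mulr0 memN_msupp_eq0 //; apply: contra_neqN m0 => mf.
    by rewrite (supp0 m).
  have c0 : f@_0 != 0 by apply: contraNneq f0 => c0; rewrite fC c0 scale0r.
  have -> : nonzeros f = [set: _].
    by apply/setP=> x; rewrite !inE fC mpolyX0 mevalZ meval1 mulr1 c0.
  by rewrite cardsT card_ffun card_ord leq_mul ?leq_subr.
have [m mf mmax] := max_exponent i f0.
set e := m i in mmax; have l0 := lead_in_neq0 i mf.
have es : (e <= s)%N by apply: leq_trans (fs m mf); rewrite -(mdeg_mdrop i) leq_addl.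
have line := nonzeros_lead_in mmax.
have {}IH : ((#|F| - (s - e)) * #|F| ^ n <= #|F| * #|nonzeros (lead_in i e f)|)%N.
  apply: (IH (A :\ i)%SET) => //.
  - by rewrite (cardsD1 i A) iA in kA; move: kA.
  - move=> m1 /msupp_lead_in[m' m'f [_ ->]] j; rewrite !inE mnmE negb_and negbK.
    by case: eqP => //= _ /(fA m' m'f).
  - move=> m1 /msupp_lead_in[m' m'f [m'e ->]].
    by have := fs m' m'f; rewrite -(mdeg_mdrop i m') m'e leq_subRL // addnC.
rewrite -(leq_pmul2l q0).
have : ((#|F| - e) * ((#|F| - (s - e)) * #|F| ^ n) <= #|F| * (#|F| * #|nonzeros f|))%N.
  apply: leq_trans (leq_mul (leqnn _) IH) _.
  by rewrite mulnCA leq_mul2l line orbT.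
apply: leq_trans; rewrite !mulnA leq_mul2r; apply/orP; right.
(* With q = [#|F|], (q - e)(q - s + e) = q(q - s) + e(s - e); for s > q the side to be bounded is
   0. *)
by have [sq|qs] := leqP s #|F|; nia.
Qed.

End AffineCount.

(** * Weighted supports, weighted shears and the lower bound on nonzeros *)

Section WeightedHomogeneous.
Variables (n : nat) (a : 'I_n -> nat).
Hypothesis a_gt0 : forall i, (0 < a i)%N.
Implicit Types (m : 'X_{1..n}) (A : {set 'I_n}).

Definition wt m := (\sum_i a i * m i)%N.

Lemma wtD m1 m2 : wt (m1 + m2)%MM = (wt m1 + wt m2)%N.
Proof. by rewrite -big_split; apply: eq_bigr => i _; rewrite mnmDE mulnDr. Qed.

Lemma mdeg_le_wt m : (mdeg m <= wt m)%N.
Proof. by rewrite mdegE; apply: leq_sum => i _; rewrite leq_pmull. Qed.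

(** Weighted homogeneity read off the monomials, together with a set [A] of admissible variables
    that shrinks when one is eliminated. *)
Definition wsupp (R : nzRingType) A d (f : {mpoly R[n]}) :=
  forall m, m \in msupp f -> wt m = d /\ forall j, j \notin A -> m j = 0%N.

Section Closure.
Variables (R : nzRingType) (A : {set 'I_n}).
Implicit Types (f g : {mpoly R[n]}).

Lemma wsuppD d f g : wsupp A d f -> wsupp A d g -> wsupp A d (f + g).
Proof.
by move=> fd gd m /msuppD_le; rewrite mem_cat => /orP[/fd|/gd].
Qed.

Lemma wsuppZ d c f : wsupp A d f -> wsupp A d (c *: f).
Proof. by move=> fd m /msuppZ_le/fd. Qed.

Lemma wsupp_sum (I : eqType) (r : seq I) (f : I -> {mpoly R[n]}) d :
  {in r, forall i, wsupp A d (f i)} -> wsupp A d (\sum_(i <- r) f i).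
Proof.
move=> fd; rewrite big_seq; elim/big_rec: _ => [m|i g ir gd]; first by rewrite msupp0.
exact: wsuppD (fd i ir) gd.
Qed.

Lemma wsupp1 : wsupp A 0 (1 : {mpoly R[n]}).
Proof.
move=> m; rewrite msupp1 inE => /eqP ->; split=> [|j _]; last by rewrite mnm0E.
by rewrite /wt big1 // => i _; rewrite mnm0E muln0.
Qed.

Lemma wsuppM d e f g : wsupp A d f -> wsupp A e g -> wsupp A (d + e) (f * g).
Proof.
move=> fd ge m /msuppM_le /allpairsP[[m1 m2] /= [/fd[w1 A1] /ge[w2 A2] ->]].
by split=> [|j jA]; rewrite ?wtD ?w1 ?w2 // mnmDE A1 ?A2.
Qed.

Lemma wsuppXn d k f : wsupp A d f -> wsupp A (d * k) (f ^+ k).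
Proof.
move=> fd; elim: k => [|k IH]; first by rewrite muln0; apply: wsupp1.
by rewrite exprS mulnS; apply: wsuppM.
Qed.

Lemma wsupp_prod (I : Type) (r : seq I) (d : I -> nat) (f : I -> {mpoly R[n]}) :
  (forall i, wsupp A (d i) (f i)) ->
  wsupp A (\sum_(i <- r) d i)%N (\prod_(i <- r) f i).
Proof.
move=> fd; elim: r => [|i r IH]; first by rewrite !big_nil; apply: wsupp1.
by rewrite !big_cons; apply: wsuppM.
Qed.

Lemma wsuppX i : i \in A -> wsupp A (a i) ('X_i : {mpoly R[n]}).
Proof.
move=> iA m; rewrite msuppX inE => /eqP ->; split=> [|j jA]; last first.
  by rewrite mnm1E; case: eqP => // ij; rewrite -ij iA in jA.
rewrite /wt (bigD1 i) //= mnm1E eqxx muln1 big1 ?addn0 // => j ji.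
by rewrite mnm1E eq_sym (negPf ji) muln0.
Qed.

End Closure.

Variable F : finFieldType.
Implicit Types (f : {mpoly F[n]}) (x : {ffun 'I_n -> F}).

Definition shear_mp (i : 'I_n) (c : 'I_n -> F) : n.-tuple {mpoly F[n]} :=
  [tuple 'X_j + c j *: 'X_i ^+ a j | j < n].

Definition shear (i : 'I_n) (c : 'I_n -> F) x : {ffun 'I_n -> F} :=
  [ffun j => x j + c j * x i ^+ a j].

Lemma meval_shear i c f x : (f \mPo shear_mp i c).@[x] = f.@[shear i c x].
Proof.
rewrite comp_mpoly_meval; apply: meval_eq => j.
by rewrite tnth_mktuple ffunE mevalD mevalZ rmorphXn /= !mevalXU.
Qed.

Lemma shearK i c : c i = 0 -> cancel (shear i c) (shear i (fun j => - c j)).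
Proof.
by move=> ci x; apply/ffunP=> j; rewrite !ffunE ci mul0r addr0 mulNr addrK.
Qed.

(** An identity of polynomials, not of values: over a finite field values alone would not show that
    shearing keeps a polynomial nonzero. *)
Lemma shear_mpK i c f : c i = 0 ->
  (f \mPo shear_mp i c) \mPo shear_mp i (fun j => - c j) = f.
Proof.
move=> ci; rewrite -[RHS]comp_mpoly_id [f \mPo shear_mp i c]comp_mpolyE.
rewrite raddf_sum [RHS]comp_mpolyE; apply: eq_bigr => m _ /=.
rewrite comp_mpolyZ rmorph_prod; congr (_ *: _); apply: eq_bigr => j _.
rewrite rmorphXn /= !tnth_mktuple rmorphD /= comp_mpolyZ rmorphXn /=.
rewrite !comp_mpolyXU -!tnth_nth !tnth_mktuple ci oppr0 scale0r addr0.
by rewrite scaleNr addrNK.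
Qed.

(** Since ['X_i] has weight 1, the added term ['X_i ^+ a j] has the same weight as ['X_j]. *)
Lemma wsupp_shear i c A d f : a i = 1%N -> i \in A ->
  wsupp A d f -> wsupp A d (f \mPo shear_mp i c).
Proof.
move=> ai iA fd; rewrite comp_mpolyE; apply: wsupp_sum => m /fd[<- mA].
apply/wsuppZ/wsupp_prod => j; rewrite tnth_mktuple.
have [jA|/mA ->] := boolP (j \in A); last by rewrite muln0; apply: wsupp1.
apply: wsuppXn; apply: wsuppD; first exact: wsuppX.
by apply: wsuppZ; have := wsuppXn (k := a j) (@wsuppX F _ _ iA); rewrite ai mul1n.
Qed.

Lemma card_nonzeros_shear i c f : c i = 0 ->
  #|nonzeros (f \mPo shear_mp i c)| = #|nonzeros f|.
Proof.
move=> ci; rewrite -[RHS](on_card_preimset (f := shear i c)).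
  by apply: eq_card => x; rewrite !inE meval_shear.
apply: onW_bij; apply: injF_bij; exact: can_inj (shearK ci).
Qed.

(** The only monomial of weight [d] with exponent at least [d] in ['X_i] is ['X_i ^+ d]. All others
    vanish on the [i]-th axis, so a zero there kills its coefficient. *)
Lemma wsupp_exponent_lt i A d f (t : F) : a i = 1%N -> t != 0 -> (0 < d)%N ->
  wsupp A d f -> f.@[[ffun j : 'I_n => if j == i then t else 0]] = 0 ->
  forall m, m \in msupp f -> (m i < d)%N.
Proof.
move=> ai t0 d0 fd ft m mf; rewrite ltnNge; apply/negP => dm.
have top m' : m' \in msupp f -> (d <= m' i)%N ->
    forall j, j != i -> m' j = 0%N.
  move=> /fd[wm' _] dm' j ji; apply/eqP; move: wm'.
  rewrite /wt (bigD1 i) //= ai mul1n (bigD1 j) //= => wm'.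
  by have := a_gt0 j; move: (\sum_(_ < _ | _) _)%N wm' => s; nia.
move: ft; rewrite mevalE (bigD1_seq m) ?msupp_uniq //=.
rewrite [X in _ + X]big1_seq ?addr0.
  move/eqP; rewrite mulf_eq0 -[_ == 0]negbK -mcoeff_msupp mf /=.
  apply/negP/prodf_neq0 => j _; rewrite ffunE; case: ifPn => [_|ji].
    by rewrite expf_neq0.
  by rewrite (top m) // expr0 oner_neq0.
move=> m' /andP[m'm m'f].
have [m'd|dm'] := ltnP (m' i) d; last first.
  case/eqP: m'm; apply/mnmP=> j; have [->|ji] := eqVneq j i.
    have [w1 _] := fd m' m'f; have [w2 _] := fd m mf.
    move: w1 w2; rewrite /wt (bigD1 i) //= big1; last first.
      by move=> k ki; rewrite (top m') // muln0.
    rewrite (bigD1 i) //= big1; last by move=> k ki; rewrite (top m) // muln0.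
    by rewrite ai; lia.
  by rewrite (top m) // (top m').
have [j ji mj] : exists2 j, j != i & m' j != 0%N.
  apply/exists_inP; apply: contraLR m'd => /exists_inPn nz; rewrite -leqNgt.
  have [<- _] := fd m' m'f; rewrite /wt (bigD1 i) //= big1 ?ai ?mul1n ?addn0 //.
  by move=> k /nz; rewrite negbK => /eqP ->; rewrite muln0.
by rewrite (bigD1 j) //= ffunE (negPf ji) expr0n (negPf mj) mul0r mulr0.
Qed.

Lemma card_nonzeros_wsupp A d f : (0 < d)%N -> f != 0 -> wsupp A d f ->
  ((#|F| - 1) * (#|F|.+1 - d) * #|F| ^ n <= #|F| ^ 2 * #|nonzeros f|)%N.
Proof.
move=> d0.
have q0 : (0 < #|F|)%N by apply/card_gt0P; exists 0.
elim: {A}_.+1 {-2}A (ltnSn #|A|) f => // k IH A; rewrite ltnS => kA f f0 fd.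
have within B (g : {mpoly F[n]}) : wsupp B d g -> msupp_within B g by move=> gd m /gd[].
have [/exists_inP[i iA /eqP ai]|/exists_inPn noone] :=
    boolP [exists i in A, a i == 1%N]; last first.
  (* All weights in [A] are at least 2, so twice the ordinary degree is at most [d]; as [d > 0], the
     degree is at most [d.-1]. *)
  have := @schwartz_zippel _ _ A d.-1 f f0 (within _ _ fd).
  have mdeg_lt m : m \in msupp f -> (mdeg m <= d.-1)%N.
    move=> /fd[wm mA]; suff : (2 * mdeg m <= d)%N by lia.
    rewrite -wm mdegE big_distrr; apply: leq_sum => j _ /=.
    have [/noone|/mA ->] := boolP (j \in A); last by rewrite muln0.
    by have := a_gt0 j; move: (a j) => aj; nia.
  move=> /(_ mdeg_lt); move: (#|nonzeros f|) => N.
  rewrite -(leq_pmul2l q0) [(_ ^ 2)%N]expnS expn1 -!mulnA; apply: leq_trans.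
  by rewrite !mulnA leq_mul2r; apply/orP; right; nia.
have [/existsP[x /andP[/eqP fx xi]]|/existsPn nozero] :=
    boolP [exists x : {ffun 'I_n -> F}, (f.@[x] == 0) && (x i != 0)]; last first.
  (* No zero has [x i != 0], which gives (q - 1) q^(n-1) nonzeros; this suffices because q + 1 - d
     <= q. *)
  have sub : (#|[pred x : {ffun 'I_n -> F} | x i != 0%R]| <= #|nonzeros f|)%N.
    apply: subset_leq_card; apply/fintype.subsetP => x; rewrite !inE => xi.
    by have := nozero x; rewrite xi andbT.
  have := leq_mul (leqnn #|F|) sub; rewrite (card_upd i).
  rewrite (eq_bigr (fun=> #|F|.-1)) => [|x _]; last first.
    rewrite -(cardC1 (0 : F)); apply: eq_card => t.
    by rewrite !inE ffunE eqxx.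
  rewrite sum_nat_const card_ffun card_ord -(leq_pmul2l q0).
  rewrite [(_ ^ 2)%N]expnS expn1 -!mulnA; apply: leq_trans.
  rewrite [(_ ^ n * _)%N]mulnC !mulnA leq_mul2r.
  by apply/orP; right; nia.
(* Chosen so that the shear sends the point of the [i]-th axis with coordinate [x i] to the zero
   [x]. *)
pose c j := if j == i then 0 else x j / x i ^+ a j.
have ci : c i = 0 by rewrite /c eqxx.
pose h := f \mPo shear_mp i c.
have h0 : h != 0.
  by apply: contraNneq f0 => h0; rewrite -(shear_mpK f ci) -/h h0 comp_mpoly0.
have hd : wsupp A d h by apply: wsupp_shear.
have hx : h.@[[ffun j : 'I_n => if j == i then x i else 0]] = 0.
  rewrite meval_shear -[RHS]fx; apply: meval_eq => j; rewrite !ffunE eqxx /c.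
  case: eqP => [->|_]; first by rewrite mul0r addr0.
  by rewrite add0r divfK // expf_neq0.
rewrite -(card_nonzeros_shear f ci) -/h.
have lt_d := wsupp_exponent_lt ai xi d0 hd hx.
have [m mh mmax] := max_exponent i h0.
have [m0|mi0] := eqVneq (m i) 0%N.
  apply: (IH (A :\ i)%SET) => //.
    by rewrite (cardsD1 i A) iA in kA; move: kA.
  move=> m' m'h; have [-> m'A] := hd m' m'h; split=> // j.
  rewrite !inE negb_and negbK => /orP[/eqP ->|/m'A //].
  by apply/eqP; rewrite -leqn0 -m0 mmax.
set e := m i in mmax mi0.
have ed : (e < d)%N := lt_d m mh.
have line := nonzeros_lead_in mmax.
(* Ordinary degree is at most weight, so removing ['X_i ^+ e] leaves degree at most [d - e]. *)
have : ((#|F| - (d - e)) * #|F| ^ n <= #|F| * #|nonzeros (lead_in i e h)|)%N.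
  apply: (@schwartz_zippel _ _ A); first exact: lead_in_neq0.
    move=> m1 /msupp_lead_in[m' m'h [_ ->]] j jA; rewrite mnmE.
    by have [_ /(_ j jA) ->] := hd m' m'h; case: ifP.
  move=> m1 /msupp_lead_in[m' m'h [m'e ->]].
  have := mdeg_le_wt m'; have [-> _] := hd m' m'h.
  by rewrite -(mdeg_mdrop i m') m'e; lia.
move=> sz; have := leq_mul (leqnn (#|F| - e)) sz; rewrite [leqRHS]mulnCA.
have := leq_mul (leqnn #|F|) line; rewrite [leqRHS]mulnA mulnn => {}line.
move/leq_trans=> /(_ _ line); apply: leq_trans.
(* For d <= q the two sides differ by (e - 1)(d - e - 1); for d > q the factor q + 1 - d is 0. *)
by rewrite mulnA leq_mul2r; apply/orP; right; have [dq|qd] := leqP d #|F|; nia.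
Qed.

End WeightedHomogeneous.

(** * Rational points of weighted projective space and their representatives over [F] *)

Section RationalPoints.
Variables (F : finFieldType) (K : closedFieldType) (iota : {rmorphism F -> K}).
Variables (n : nat) (a : 'I_n.+1 -> nat).
Hypothesis a_gt0 : forall i, (0 < a i)%N.
Implicit Types (f : {mpoly F[n.+1]}) (l : K) (x y : {ffun 'I_n.+1 -> F}).
Implicit Types (u v : {ffun 'I_n.+1 -> K}).

(** Such a [z] is a root of X^q - X, which is the product of the X - c over all c in [F]. *)
Lemma frob_fixedP (z : K) : z ^+ #|F| = z -> exists c, z = iota c.
Proof.
move=> zq; have /(congr1 (fun p => (map_poly iota p).[z])) := finField_genPoly F.
rewrite rmorphB rmorph_prod /= map_polyXn map_polyX hornerD hornerN hornerXn hornerX.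
rewrite zq subrr horner_prod => /esym/eqP/prodf_eq0[c _].
by rewrite map_polyXsubC hornerXsubC subr_eq0 => /eqP ->; exists c.
Qed.

Lemma closed_root k (z : K) : (0 < k)%N -> exists l, l ^+ k = z.
Proof.
move=> k0; have /closed_rootP[l] : size ('X^k - z%:P) != 1%N.
  by rewrite size_XnsubC // eqSS -lt0n.
by rewrite rootE !hornerE subr_eq0 => /eqP; exists l.
Qed.

Lemma wact1 u : wact a 1 u = u.
Proof. by apply/ffunP=> i; rewrite ffunE expr1n mul1r. Qed.

Lemma wactM l l' u : wact a (l * l') u = wact a l (wact a l' u).
Proof. by apply/ffunP=> i; rewrite !ffunE exprMn mulrA. Qed.

Lemma wclass_eqP u v :
  wclass a u = wclass a v <-> exists2 l, l != 0 & v = wact a l u.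
Proof.
split=> [uv|[l l0 ->]].
  have : wclass a v v by exists 1; rewrite ?wact1 //=; apply: oner_neq0.
  by rewrite -uv => -[l l0 <-]; exists l.
apply/seteqP; split=> w [l' /= l'0 <-].
  exists (l' / l); first by rewrite /= mulf_neq0 ?invr_eq0.
  by rewrite -wactM divfK.
by exists (l' * l); rewrite /= ?mulf_neq0 // wactM.
Qed.

Lemma mcoeff_comp_scale l (g : {mpoly K[n.+1]}) m :
  (g \mPo [tuple l ^+ a i *: 'X_i | i < n.+1])@_m = l ^+ wt a m * g@_m.
Proof.
rewrite comp_mpolyE raddf_sum /= (eq_bigr (fun m' =>
  (l ^+ wt a m' * g@_m') * (m' == m)%:R)) => [|m' _]; last first.
  under eq_bigr do rewrite tnth_mktuple exprZn.
  rewrite scaler_prod -mpolyXE_id !mcoeffZ mcoeffX mulrA mulrC.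
  rewrite mulrC [g@_m' * _]mulrC /wt -prodrXr; congr (_ * _ * _).
  by apply: eq_bigr => i _; rewrite exprM.
have [mg|mg] := boolP (m \in msupp g); last first.
  rewrite (memN_msupp_eq0 mg) mulr0 big1_seq // => m' /andP[_ m'g].
  by case: eqP => [E|]; [rewrite E (negPf mg) in m'g | rewrite mulr0].
rewrite (bigD1_seq m) ?msupp_uniq //= eqxx mulr1 big1 ?addr0 // => m' /negPf ->.
by rewrite mulr0.
Qed.

Lemma wsupp_whomog d f : wsupp a [set: _] d f -> whomog iota a d f.
Proof.
move=> fd l _; apply/mpolyP=> m; rewrite mcoeff_comp_scale mcoeffZ mcoeff_map_mpoly.
have [/fd[-> //]|/memN_msupp_eq0 ->] := boolP (m \in msupp f).
by rewrite raddf0 !mulr0.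
Qed.

(** For j < k, a nonroot of X (X^(k-j) - 1), available over a closed field, separates the two
    powers. *)
Lemma exp_inj_nat j k : (forall l, l != 0 -> l ^+ j = l ^+ k) -> j = k.
Proof.
wlog jk : j k / (j <= k)%N.
  move=> H E; have [/H|/ltnW/H] := leqP j k; first exact.
  by move=> kj; apply/esym/kj => l l0; rewrite E.
move=> E; apply/eqP; rewrite eqn_leq jk leqNgt; apply/negP=> lt_jk.
have p0 : ('X * ('X^(k - j) - 1%:P) : {poly K}) != 0.
  by rewrite mulf_neq0 ?polyX_eq0 // -size_poly_eq0 size_XnsubC ?subn_gt0.
have [l] := closed_nonrootP _ p0.
rewrite rootM negb_or !rootE !hornerE subr_eq0 => /andP[l0 /eqP[]].
by apply: (mulIf (expf_neq0 j l0)); rewrite mul1r -exprD subnK // E.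
Qed.

(** Comparing the nonzero coefficients at [m] shows that [l ^+ wt a m = l ^+ d] for every nonzero
    [l]. *)
Lemma whomog_wsupp d f : whomog iota a d f -> wsupp a [set: _] d f.
Proof.
move=> fd m mf; split=> [|j]; last by rewrite inE.
apply: exp_inj_nat => l l0.
have /(congr1 (mcoeff m)) := fd l l0; rewrite mcoeff_comp_scale mcoeffZ.
apply: mulIf; rewrite mcoeff_map_mpoly fmorph_eq0.
by rewrite -mcoeff_msupp.
Qed.

Lemma meval_wact d f l u : whomog iota a d f -> l != 0 ->
  (map_mpoly iota f).@[wact a l u] = l ^+ d * (map_mpoly iota f).@[u].
Proof.
move=> fd l0; rewrite -mevalZ -(fd l l0) comp_mpoly_meval; apply: meval_eq => i.
by rewrite tnth_mktuple mevalZ mevalXU ffunE.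
Qed.

Definition lift_pt x : {ffun 'I_n.+1 -> K} := [ffun i => iota (x i)].

Lemma meval_lift f x : (map_mpoly iota f).@[lift_pt x] = iota f.@[x].
Proof.
rewrite mevalE (perm_big _ (msupp_map_mpoly _ (fmorph_inj iota))) /= mevalE.
rewrite rmorph_sum; apply: eq_bigr => m _.
rewrite mcoeff_map_mpoly rmorphM rmorph_prod; congr (_ * _).
by apply: eq_bigr => i _; rewrite ffunE rmorphXn.
Qed.

Lemma lift_pt_eq0 x : (lift_pt x == 0) = (x == 0).
Proof.
apply/eqP/eqP=> [/ffunP x0|->]; apply/ffunP=> i.
  by apply: (fmorph_inj iota); have := x0 i; rewrite !ffunE rmorph0.
by rewrite !ffunE rmorph0.
Qed.

Lemma wact_eq0 l u : l != 0 -> (wact a l u == 0) = (u == 0).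
Proof.
move=> l0; apply/eqP/eqP=> [/ffunP u0|->]; apply/ffunP=> i; last first.
  by rewrite !ffunE mulr0.
have /eqP := u0 i; rewrite !ffunE mulf_eq0 expf_eq0 (negPf l0) andbF.
by move/eqP.
Qed.

Definition proj_zeros f := [set x : {ffun 'I_n.+1 -> F} | (x != 0) && (f.@[x] == 0)].

Lemma frob_lift x : frob F (lift_pt x) = lift_pt x.
Proof. by apply/ffunP=> i; rewrite !ffunE -rmorphXn /= expf_card. Qed.

(* Hilbert 90: if the Frobenius image of [u] is [wact l u], then acting on [u]
   by a [(q-1)]-th root of the inverse of [l] makes it Frobenius-invariant. *)
Lemma rational_lift u : wclass a u = wclass a (frob F u) ->
  exists x, wclass a u = wclass a (lift_pt x).
Proof.
case/wclass_eqP=> l l0 /ffunP ul.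
have q1 : (0 < #|F|.-1)%N by rewrite -subn1 subn_gt0 finNzRing_gt1.
have [k kl] := closed_root l^-1 q1.
have k0 : k != 0.
  by apply: contraNneq l0 => k0; rewrite -invr_eq0 -kl k0 expr0n -leqn0 leqNgt q1.
have /choice[x xE] i : exists c, wact a k u i = iota c.
  apply: frob_fixedP; have := ul i; rewrite !ffunE exprMn => ->.
  rewrite -exprM mulnC exprM -[#|F|](@prednK #|F|) ?(ltnW (finNzRing_gt1 F)) //.
  by rewrite exprSr kl mulrA -exprMn mulrAC mulVf // mul1r.
exists (finfun x); apply/wclass_eqP; exists k => //.
by apply/ffunP=> i; rewrite xE !ffunE.
Qed.

Lemma rat_zerosE d f : whomog iota a d f ->
  rat_zeros iota a f = [set wclass a (lift_pt x) | x in [set` proj_zeros f]]%classic.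
Proof.
move=> fd; apply/seteqP; split=> [c [u [u0 /rational_lift[x ux] fu] <-]|c [x]].
  have /wclass_eqP[l l0 xl] := ux.
  exists x; last by [].
  rewrite /= inE -lift_pt_eq0 xl wact_eq0 // u0 /=.
  by rewrite -(fmorph_eq0 iota) -meval_lift xl (meval_wact _ fd) // fu mulr0.
rewrite /= inE => /andP[x0 /eqP fx] <-; exists (lift_pt x) => //.
by split; rewrite ?frob_lift ?lift_pt_eq0 // meval_lift fx rmorph0.
Qed.

Lemma expr_gcdn_eq1 l j k : l ^+ j = 1 -> l ^+ k = 1 -> l ^+ gcdn j k = 1.
Proof.
have [->|j0] := posnP j; first by rewrite gcd0n.
move=> lj lk; have [p r e _] := egcdnP k j0.
have : l ^+ (p * j) = l ^+ (r * k + gcdn j k) by rewrite e.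
by rewrite exprD mulnC [(r * k)%N]mulnC !exprM lj lk !expr1n mul1r => <-.
Qed.

(* With [g] the gcd of the weights on the support of [x], the points of
   [F^(n+1)] equivalent to [x] are the [x_i * c ^ (a_i / g)], and [c] is
   determined by the point. *)
Lemma card_wclass_fiber x : x != 0 ->
  #|[pred y | wclass a (lift_pt y) == wclass a (lift_pt x)]| = #|F|.-1.
Proof.
move=> x0; pose g := \big[gcdn/0%N]_(i | x i != 0) a i.
have gdvd i : x i != 0 -> (g %| a i)%N by move=> xi; rewrite /g; exact: (biggcdn_inf i).
have g0 : (0 < g)%N.
  have [i xi] : exists i, x i != 0.
    apply/existsP; apply: contraNT x0 => /existsPn x0.
    by apply/eqP/ffunP=> i; have := x0 i; rewrite negbK ffunE => /eqP.
  by have := gdvd i xi; case: posnP => // ->; rewrite dvd0n eqn0Ngt a_gt0.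
have gE i : x i != 0 -> a i = (g * (a i %/ g))%N.
  by move/gdvd => gi; rewrite mulnC divnK.
have exp_g l : (forall i, x i != 0 -> l ^+ a i = 1) -> l ^+ g = 1.
  move=> l1; rewrite /g; elim/big_ind: _ => //; exact: expr_gcdn_eq1.
pose phi (c : F) : {ffun 'I_n.+1 -> F} := [ffun i => c ^+ (a i %/ g) * x i].
(* If two images agree, a [g]-th root [l] of [c / c'] has [l ^+ a i = 1] on the support of [x],
   hence [l ^+ g = 1]. *)
have phi_inj : {in predC1 0 &, injective phi}.
  move=> c c'; rewrite !inE => c0 c'0 /ffunP cc'.
  have [l lg] := closed_root (iota (c / c')) g0.
  suff : iota (c / c') = 1.
    by move/eqP; rewrite fmorph_eq1 => /eqP/divr1_eq.
  rewrite -lg; apply: exp_g => i xi; rewrite (gE i xi) exprM lg.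
  have := cc' i; rewrite !ffunE => /(mulIf xi) e.
  by rewrite -rmorphXn expr_div_n e divff ?rmorph1 // expf_neq0.
rewrite -(cardC1 (0 : F)) -(card_in_image phi_inj); apply: eq_card => y.
rewrite !inE; apply/eqP/fintype.imageP => [/esym/wclass_eqP[l l0 /ffunP yl]|[c]].
  have lx i : x i != 0 -> l ^+ a i = iota (y i / x i).
    move=> xi; have := yl i; rewrite !ffunE fmorph_div => ->.
    by rewrite mulfK ?fmorph_eq0.
  (* On the support [l ^+ a i] lies in [F], so the power q - 1 of [l] satisfies the hypothesis of
     [exp_g]. *)
  have /frob_fixedP[c lc] : (l ^+ g) ^+ #|F| = l ^+ g.
    have q0 : (0 < #|F|)%N := ltnW (finNzRing_gt1 F).
    rewrite -(prednK q0) exprS -exprM mulnC exprM (exp_g (l ^+ _)) ?mulr1 // => i xi.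
    apply: (mulIf (expf_neq0 (a i) l0)); rewrite mul1r -exprM mulnC exprM -exprSr.
    by rewrite prednK // lx // -rmorphXn /= expf_card.
  exists c; first by rewrite !inE -(fmorph_eq0 iota) -lc expf_neq0.
  apply/ffunP=> i; apply: (fmorph_inj iota); have := yl i; rewrite !ffunE => ->.
  rewrite rmorphM rmorphXn /= -lc; have [->|xi] := eqVneq (x i) 0.
    by rewrite rmorph0 !mulr0.
  by rewrite -exprM -gE.
rewrite !inE => c0 ->; apply/esym/wclass_eqP.
have [l lg] := closed_root (iota c) g0.
exists l.
  apply: contraNneq c0 => l0; rewrite -(fmorph_eq0 iota) -lg l0 expr0n.
  by rewrite eqn0Ngt g0.
apply/ffunP=> i; rewrite !ffunE rmorphM rmorphXn /= -lg.
have [->|xi] := eqVneq (x i) 0; first by rewrite rmorph0 !mulr0.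
by rewrite -exprM -gE.
Qed.

(** By [rat_zerosE], taking classes maps [proj_zeros f] onto the rational zeros; all fibres have
    [#|F|.-1] elements, and a double count concludes. *)
Lemma card_rat_zeros d f : whomog iota a d f ->
  exists2 N, (#|F|.-1 * N)%N = #|proj_zeros f| & (rat_zeros iota a f #= `I_N)%card.
Proof.
move=> fd; pose cls x := wclass a (lift_pt x).
pose X : {fset set {ffun 'I_n.+1 -> K}} := [fset cls x | x in proj_zeros f]%fset.
exists #|` X|%fset; last first.
  rewrite (rat_zerosE fd).
  suff -> : ([set wclass a (lift_pt x) | x in [set` proj_zeros f]] = [set` X])%classic.
    exact/card_eq_fsetP.
  apply/seteqP; split=> [c [x xZ <-]|c /imfsetP[x xZ ->]]; last by exists x.
  by apply/imfsetP; exists x.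
have fiber c : c \in X -> #|[pred x in proj_zeros f | cls x == c]| = #|F|.-1.
  case/imfsetP=> x; rewrite /= inE => /andP[x0 fx] ->.
  rewrite -(card_wclass_fiber x0); apply: eq_card => y; rewrite !inE andb_idl //.
  move/eqP/esym/wclass_eqP=> [l l0 yl].
  rewrite -lift_pt_eq0 -(fmorph_eq0 iota) -meval_lift yl wact_eq0 //.
  by rewrite lift_pt_eq0 x0 (meval_wact _ fd) // meval_lift (eqP fx) rmorph0 mulr0 eqxx.
transitivity (\sum_(c <- X) \sum_(x in proj_zeros f) (cls x == c))%N.
  rewrite big_seq (eq_bigr (fun=> #|F|.-1)) => [|c /fiber <-]; last first.
    by rewrite -sum1_card big_mkcondr.
  by rewrite -big_seq big_const_seq count_predT iter_addn_0.
rewrite exchange_big /= -sum1_card; apply: eq_bigr => x xZ.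
have xX : cls x \in X by apply/imfsetP; exists x.
rewrite (bigD1_seq (cls x)) ?fset_uniq //= eqxx big1 // => c.
by rewrite eq_sym => /negPf ->.
Qed.

End RationalPoints.

(** * The extremal product of linear forms *)

Section Extremal.
Variables (F : finFieldType) (n d : nat) (i0 i1 : 'I_n).
Hypothesis i01 : i0 != i1.

Let k := minn d #|F|.
Let D := take k (enum F).

(** For [d <= #|F|] there are [d] distinct slopes and no power of ['X_i0]. For larger [d] all slopes
    and a positive power of ['X_i0] occur, so the product vanishes everywhere. *)
Definition linear_product : {mpoly F[n]} :=
  'X_i0 ^+ (d - k) * \prod_(c <- D) ('X_i1 - c *: 'X_i0).

Lemma size_slopes : size D = k.
Proof. by rewrite size_takel // -cardE geq_minr. Qed.

Lemma linear_product_neq0 : linear_product != 0.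
Proof.
rewrite mulf_neq0 //.
  by rewrite expf_neq0 // -msupp_eq0 msuppX.
rewrite prodf_seq_neq0; apply/allP=> c _ /=.
have : ('X_i1 - c *: 'X_i0 : {mpoly F[n]})@_U_(i1) != 0.
  rewrite mcoeffB mcoeffZ !mcoeffX eqxx.
  case: (U_(i0)%MM =P _) => [/mnmP e|_]; last by rewrite mulr0 subr0 oner_neq0.
  by have := e i0; rewrite !mnm1E eqxx eq_sym (negPf i01).
by apply: contraNneq => ->; rewrite mcoeff0.
Qed.

Lemma wsupp_linear_product (a : 'I_n -> nat) :
  a i0 = 1%N -> a i1 = 1%N -> wsupp a [set: _] d linear_product.
Proof.
move=> a0 a1; have X0 := @wsuppX _ a F _ _ (finset.in_setT i0).
have X1 := @wsuppX _ a F _ _ (finset.in_setT i1).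
rewrite a0 in X0; rewrite a1 in X1.
have <- : ((1 * (d - k)) + \sum_(c <- D) 1 = d)%N.
  by rewrite mul1n sum1_size size_slopes subnK // geq_minl.
apply: wsuppM; first exact: wsuppXn X0.
apply: wsupp_prod => c; apply: wsuppD X1 _; rewrite -scaleNr; exact: wsuppZ X0.
Qed.

Lemma card_nonzeros_linear_product : (0 < d)%N ->
  (#|F| ^ 2 * #|nonzeros linear_product| = (#|F| - 1) * (#|F|.+1 - d) * #|F| ^ n)%N.
Proof.
move=> d0; have q1 := finNzRing_gt1 F.
have evalE x : linear_product.@[x] =
    x i0 ^+ (d - k) * \prod_(c <- D) (x i1 - c * x i0).
  rewrite mevalM rmorphXn rmorph_prod /= mevalXU; congr (_ * _).
  by apply: eq_bigr => c _; rewrite mevalB mevalZ !mevalXU.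
have [dq|qd] := leqP d #|F|; last first.
  have -> : (#|F|.+1 - d = 0)%N by lia.
  rewrite muln0 mul0n; apply/eqP; rewrite muln_eq0 cards_eq0; apply/orP; right.
  apply/eqP/setP=> x; rewrite !inE evalE; apply/negbTE; rewrite negbK.
  have kE : k = #|F| by rewrite /k; lia.
  have [x0|x0] := eqVneq (x i0) 0.
    by rewrite x0 expr0n subn_eq0 kE leqNgt qd mul0r.
  rewrite mulf_eq0; apply/orP; right; rewrite prodf_seq_eq0; apply/hasP.
  exists (x i1 / x i0); last by rewrite divfK // subrr eqxx.
  by rewrite /D kE cardE take_size mem_enum.
have kE : k = d by rewrite /k; lia.
have card0 : (#|F| * #|[pred x : {ffun 'I_n -> F} | x i0 == 0%R]| = #|F| ^ n)%N.
  rewrite (card_upd i0) -[n in RHS]card_ord -card_ffun -sum1_card.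
  apply: eq_bigr => x _; rewrite -(card1 (0 : F)); apply: eq_card => t.
  by rewrite !inE ffunE eqxx.
have cardC0 : (#|[pred x : {ffun 'I_n -> F} | x i0 == 0%R]|
    + #|[pred x : {ffun 'I_n -> F} | x i0 != 0%R]| = #|F| ^ n)%N.
  rewrite -[n in RHS]card_ord -card_ffun.
  by rewrite -(cardC [pred x : {ffun 'I_n -> F} | x i0 == 0]).
have -> : #|nonzeros linear_product| =
    #|[pred x : {ffun 'I_n -> F} | \prod_(c <- D) (x i1 - c * x i0) != 0]|.
  apply: eq_card => x.
  by rewrite !inE evalE kE subnn expr0 mul1r.
rewrite [(_ ^ 2)%N]expnS expn1 -mulnA (card_upd i1).
rewrite (bigID (fun x : {ffun 'I_n -> F} => x i0 == 0)) /=.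
(* Where [x i0 = 0] every factor equals [t]; as [d > 0] there is at least one, so exactly [t = 0] is
   excluded. *)
rewrite (eq_bigr (fun=> #|F| - 1)%N) => [|x /eqP x0]; last first.
  rewrite subn1 -(cardC1 (0 : F)); apply: eq_card => t.
  rewrite !inE prodf_seq_neq0 !ffunE eqxx (negPf i01) x0.
  under eq_all do rewrite mulr0 subr0.
  have : (0 < size D)%N by rewrite size_slopes kE.
  by case: D => //= c s _; case: (t != 0) => //=; elim: s.
(* Where [x i0 != 0] the product is nonzero exactly when the slope [t / x i0] lies outside [D]. *)
rewrite [X in (_ + X)%N](eq_bigr (fun=> #|F| - d)%N) => [|x x0]; last first.
  rewrite -kE -size_slopes -(cardC (mem D)).
  rewrite (card_uniqP _) ?take_uniq ?enum_uniq // addKn.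
  rewrite -[RHS](fintype.card_image (mulIf x0)); apply: eq_card => t.
  rewrite !inE !ffunE eqxx (negPf i01) prodf_seq_neq0.
  apply/allP/fintype.imageP => [nz|[c]].
    exists (t / x i0); rewrite ?divfK // !inE; apply/negP => /nz.
    by rewrite /= divfK // subrr eqxx.
  rewrite !inE => cD -> c' c'D /=; rewrite -mulrBl mulf_neq0 // subr_eq0.
  by apply: contraNneq cD => ->.
rewrite !sum_nat_const.
set A := #|_| in card0 cardC0 *; set B := #|_| in cardC0; rewrite -/B.
have BE : B = ((#|F| - 1) * A)%N by rewrite mulnBl mul1n card0 -cardC0 addKn.
rewrite BE -card0 subSn //; move: (#|F| - 1)%N (#|F| - d)%N => b e.
by rewrite [RHS]mulnCA; congr (_ * _)%N; nia.
Qed.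

End Extremal.

(** * Arithmetic of the numbers p_m and comparison of the counts *)

Lemma pgeomE q (k : nat) : (0 < q)%N -> (q.-1 * pgeom q k%:Z + 1 = q ^ k.+1)%N.
Proof. by move=> q0; rewrite /= -predn_exp addn1 prednK // expn_gt0 q0. Qed.

Lemma pgeom_sub2E q (n : nat) : (0 < q)%N -> (1 <= n)%N ->
  (q.-1 * pgeom q (n%:Z - 2) + 1 = q ^ n.-1)%N.
Proof.
(* For n = 1 the convention p_(-1) = 0 matches q^0 = 1. *)
move=> q0; case: n => [|[|n]] // _; first by rewrite muln0.
have -> : n.+2%:Z - 2 = n%:Z by lia.
exact: pgeomE.
Qed.

(** Used with Q = q^(n-1), P = p_n and P2 = p_(n-2). Then P = (q + 1) Q + P2, so the minimum
    switches at d = q + 1, where the truncated q + 1 - d becomes 0. *)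
Lemma min_pgeom_bound q d Q P P2 : (1 < q)%N ->
  (q.-1 * P + 1 = q ^ 2 * Q)%N -> (q.-1 * P2 + 1 = Q)%N ->
  (q.-1 * minn P (d * Q + P2) + 1 + (q - 1) * (q.+1 - d) * Q = q ^ 2 * Q)%N.
Proof.
case: q => [//|[//|p]] _ /= EP EP2.
have PE : P = (p.+3 * Q + P2)%N.
  have e : (p.+1 * (p.+3 * Q + P2) + 1 = p.+2 ^ 2 * Q)%N.
    by rewrite mulnDr -addnA EP2; lia.
  by apply/eqP; rewrite -(eqn_pmul2l (ltn0Sn p)) -(eqn_add2r 1) EP e.
have [dp|/ltnW pd] := leqP d p.+3; last first.
  have /minn_idPl -> : (P <= d * Q + P2)%N.
    by rewrite PE leq_add2r leq_mul2r pd orbT.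
  by rewrite (eqP pd) muln0 mul0n addn0.
have /minn_idPr -> : (d * Q + P2 <= P)%N.
  by rewrite PE leq_add2r leq_mul2r dp orbT.
rewrite subn1 /= mulnDr -(addnA _ (_ * P2)%N) EP2.
transitivity ((p.+1 * (p.+3 - d + d) + 1) * Q)%N.
  by move: (p.+3 - d)%N => e; nia.
by rewrite subnK //; congr (_ * _)%N; lia.
Qed.

Lemma card_proj_zeros (F : finFieldType) n d
    (f : {mpoly F[n.+1]}) (a : 'I_n.+1 -> nat) :
  (0 < d)%N -> (forall i, (0 < a i)%N) -> wsupp a [set: _] d f ->
  (#|proj_zeros f| + 1 + #|nonzeros f| = #|F| ^ n.+1)%N.
Proof.
move=> d0 a0 fd.
(* Positive weight forces a variable into every monomial, so the origin is a zero; it accounts for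
   the summand 1. *)
have f00 : f.@[0 : {ffun 'I_n.+1 -> F}] = 0.
  rewrite mevalE big1_seq // => m /andP[_ /fd[wm _]].
  have [i mi] : exists i, m i != 0%N.
    apply/existsP; apply: contraLR d0 => /existsPn m0; rewrite -wm -eqn0Ngt.
    by apply/eqP/big1 => i _; have := m0 i; rewrite negbK => /eqP ->; rewrite muln0.
  by rewrite (bigD1 i) //= ffunE expr0n (negPf mi) mul0r mulr0.
rewrite -[n.+1 in RHS]card_ord -card_ffun -(cardsC (nonzeros f)) addnC; congr addn.
rewrite [RHS](finset.cardsD1 (0 : {ffun 'I_n.+1 -> F})) !inE f00 eqxx addnC; congr addn.
by apply: eq_card => x; rewrite !inE negbK.
Qed.

Theorem theorem5p1 (q : nat) (F : finFieldType) (hq : #|F| = q)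
  (K : closedFieldType) (iota : {rmorphism F -> K})
  (K_alg : integralRange iota)
  (n : nat) (hn : (1 <= n)%N) (a : 'I_n.+1 -> nat)
  (a01 : forall i : 'I_n.+1, (i < 2)%N -> a i = 1%N)
  (a_gt0 : forall i : 'I_n.+1, (0 < a i)%N)
  (d : nat) (hd : (1 <= d)%N) :
  is_e_q iota a d
    (minn (pgeom q n%:Z) (d * q ^ n.-1 + pgeom q (n%:Z - 2))%N).
Proof.
have q1 : (1 < q)%N by rewrite -hq finNzRing_gt1.
have q0 := ltnW q1; have p0 : (0 < q.-1)%N by rewrite -ltnS prednK.
have qn : (q ^ n.+1 = q ^ 2 * q ^ n.-1)%N by rewrite -expnD add2n prednK.
have pn := pgeomE n q0; rewrite qn in pn; have pn2 := pgeom_sub2E q0 hn.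
(* The claimed value thus corresponds to (q - 1)(q + 1 - d) q^(n-1) nonzeros, and with [count] both
   halves become comparisons of nonzeros. *)
have minE := min_pgeom_bound d q1 pn pn2; rewrite -qn in minE.
have count f : wsupp a [set: _] d f -> exists2 N,
    (q.-1 * N + 1 + #|nonzeros f| = q ^ n.+1)%N & (rat_zeros iota a f #= `I_N)%card.
  move=> fd; have [N NE fN] := card_rat_zeros a_gt0 (wsupp_whomog iota fd).
  by exists N => //; rewrite -hq NE; apply: card_proj_zeros fd.
split=> [|f /whomog_wsupp fd f0].
  pose i0 : 'I_n.+1 := inord 0; pose i1 : 'I_n.+1 := inord 1.
  have i01 : i0 != i1 by rewrite -val_eqE /= !inordK.
  have a0 : a i0 = 1%N by rewrite a01 // inordK.
  have a1 : a i1 = 1%N by rewrite a01 // inordK.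
  have fd := @wsupp_linear_product F _ d _ _ a a0 a1.
  exists (linear_product F d i0 i1); split; first exact: wsupp_whomog.
    exact: linear_product_neq0.
  have [N NE fN] := count _ fd.
  suff -> : minn (pgeom q n) (d * q ^ n.-1 + pgeom q (n%:Z - 2)) = N by [].
  have := card_nonzeros_linear_product F i01 hd; rewrite hq qn mulnCA.
  move/eqP; rewrite eqn_pmul2l ?expn_gt0 ?q0 // => /eqP nz; rewrite nz in NE.
  have eN := addIn (addIn (etrans minE (esym NE))).
  by apply/eqP; rewrite -(eqn_pmul2l p0) eN.
have [N NE fN] := count _ fd.
have [le_N _] := (card_eqPle _ _).1 fN.
apply: card_le_trans le_N _; rewrite card_le_II.
have := card_nonzeros_wsupp a_gt0 hd f0 fd; rewrite hq qn mulnCA.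
rewrite leq_pmul2l ?expn_gt0 ?q0 // => nz.
rewrite -(leq_pmul2l p0) -(leq_add2r 1) -(leq_add2r #|nonzeros f|) NE -minE.
by rewrite leq_add2l.
Qed.
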